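(* Let $(\mathbb{S},\Sigma)$ be a measurable space, let a sequence of measures $\{\mu_n\}_{n\ge 1}$ on $(\mathbb{S},\Sigma)$ converge setwise to a finite measure $\mu$, and let $\{f_n\}_{n\ge 1}$ be a pointwise nondecreasing sequence of measurable $[-\infty,+\infty]$-valued functions on $\mathbb{S}$ such that the integrals $\int_{\mathbb{S}} f_n\,d\mu_n$ are defined. Let $f(s):=\lim_{n\to\infty} f_n(s)$, $s\in\mathbb{S}$. If the functions $f_1^-$ and $f^+$ are asymptotically uniformly integrable with respect to $\{\mu_n\}_{n\ge 1}$, then $$\lim_{n\to\infty}\int_{\mathbb{S}} f_n(s)\,\mu_n(ds)=\int_{\mathbb{S}} f(s)\,\mu(ds).$$
   Context: For a function $h$, $h^+=\max\{h,0\}$ and $h^-=-\min\{h,0\}$. The integral $\int h\,d\mu$ of a measurable $[-\infty,+\infty]$-valued function is defined if $\min\{\int h^+d\mu,\int h^-d\mu\}<+\infty$, and then equals $\int h^+d\mu-\int h^-d\mu$. Setwise convergence: $\mu_n(C)\to\mu(C)$ for every $C\in\Sigma$. A single function $h$ is asymptotically uniformly integrable with respect to $\{\mu_n\}$ if $\lim_{K\to+\infty}\limsup_{n\to\infty}\int |h(s)|\,\mathbf{1}\{|h(s)|\ge K\}\,\mu_n(ds)=0$. *)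

(* Defs.v *)
From mathcomp Require Import all_boot all_order all_algebra.
From mathcomp Require Import all_classical all_reals all_analysis.
From mathcomp Require Import measurable_realfun.

Set Implicit Arguments.
Unset Strict Implicit.
Unset Printing Implicit Defensive.

Import Order.TTheory GRing.Theory Num.Theory.
Import numFieldNormedType.Exports.

Local Open Scope classical_set_scope.
Local Open Scope ring_scope.
Local Open Scope ereal_scope.

(* [\int[mu]_x h x] is total and takes the value [-oo] when both parts have
   infinite integral, so well-definedness has to be asserted separately. *)
Definition integral_defined d (T : measurableType d) (R : realType)
    (mu : {measure set T -> \bar R}) (h : T -> \bar R) : Prop :=
  mine (\int[mu]_x h^\+ x) (\int[mu]_x h^\- x) < +oo.

Definition setwise_converges d (T : measurableType d) (R : realType)
    (mu_ : {measure set T -> \bar R}^nat) (mu : {measure set T -> \bar R}) :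
    Prop :=
  forall C, measurable C -> mu_ n C @[n --> \oo] --> mu C.

Definition asymptotically_uniformly_integrable d (T : measurableType d)
    (R : realType) (mu_ : {measure set T -> \bar R}^nat) (h : T -> \bar R) :
    Prop :=
  (fun K : R => limn_esup (fun n =>
    \int[mu_ n]_x (`|h x| * (\1_[set y | (K%:E <= `|h y|)%E] x)%:E)))
    @ +oo%R --> 0.

(* Main.v *)
(* Fatou's lemma for setwise convergence: for nonnegative g_n increasing to g,
   every a < \int g dmu is exceeded by the integral of a simple function below
   some g_m, and integrals of simple functions converge along mu_n; hence
   a < \int g_n dmu_n eventually.  It extends to increasing g_n whose first
   negative part is asymptotically uniformly integrable by applying it to
   (g_n + K)^+, whose mu_n-integral differs from \int g_n dmu_n + K mu_n(S) by at
   most the tail of g_0^- above K.  The corollary follows from this Fatou lemma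
   for f_n (lower bound) and for the constant sequence -f (upper bound, since
   f_n <= f). *)

Require Import Defs.
From mathcomp Require Import all_boot all_order all_algebra.
From mathcomp Require Import all_classical all_reals all_analysis.
From mathcomp Require Import measurable_realfun.
From mathcomp Require Import lra.
Import Order.TTheory GRing.Theory Num.Theory.
Import numFieldNormedType.Exports.
Local Open Scope classical_set_scope.
Local Open Scope ring_scope.
Local Open Scope ereal_scope.

Import HBNNSimple.

Set Implicit Arguments.
Unset Strict Implicit.
Unset Printing Implicit Defensive.

(** * Setwise convergence: simple functions and the nonnegative Fatou lemma *)

Lemma cvg_sintegral_setwise d (S : measurableType d) (R : realType)
    (mu_ : {measure set S -> \bar R}^nat) (mu : {measure set S -> \bar R})
    (h : {nnsfun S >-> R}) :
  setwise_converges mu_ mu ->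
  sintegral (mu_ n) h @[n --> \oo] --> sintegral mu h.
Proof.
move=> mu_cvg.
have sintE (m : {measure set S -> \bar R}) : sintegral m h =
    \sum_(x <- finmap.enum_fset (fset_set (range h)) | x \in finmap.enum_fset (fset_set (range h)))
      x%:E * m (h @^-1` [set x]).
  (* The index set is the range of [h], the same for every measure, so the limit can be taken term
     by term. *)
  by rewrite sintegralE fsbig_finite//= big_seq.
rewrite sintE; under eq_fun do rewrite sintE.
apply: cvg_nnesum => r rh.
  apply: nearW => n; apply: mule_ge0 => //.
  by move: rh; rewrite in_fset_set// inE => -[s _ <-]; rewrite lee_fin.
by apply: cvgeZl => //; apply: mu_cvg.
Qed.

Lemma fatou_setwise d (S : measurableType d) (R : realType)
    (mu_ : {measure set S -> \bar R}^nat) (mu : {measure set S -> \bar R})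
    (g_ : (S -> \bar R)^nat) (a : \bar R) :
  setwise_converges mu_ mu ->
  (forall n, measurable_fun [set: S] (g_ n)) ->
  (forall n s, 0 <= g_ n s) ->
  (forall s, nondecreasing_seq (fun n => g_ n s)) ->
  a < \int[mu]_s limn (g_ ^~ s) ->
  \forall n \near \oo, a < \int[mu_ n]_s g_ n s.
Proof.
move=> mu_cvg mg g0 ndg alt.
have /(_ _ (open_ereal_gt' alt))[m _ /(_ m (leqnn m))/=] :=
  @cvg_monotone_convergence _ _ _ mu _ measurableT g_ mg
    (fun n s _ => g0 n s) (fun s _ => ndg s).
rewrite ge0_integralTE// => /ereal_sup_gt[_ /= [h hg <-] ah].
have /(_ _ (open_ereal_gt' ah)) ah_ := cvg_sintegral_setwise (h := h) mu_cvg.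
(* [m] and [h] are now fixed; only the measure varies, and [g_ m <= g_ n] as soon as [n >= m]. *)
near=> n.
apply: (@lt_le_trans _ _ (sintegral (mu_ n) h)); first by near: n.
apply: (@le_trans _ _ (\int[mu_ n]_s g_ m s)).
  by rewrite ge0_integralTE//; apply: ereal_sup_ubound; exists h.
apply: ge0_le_integral => // s _; apply: ndg; near: n.
by exists m.
Unshelve. all: by end_near. Qed.

(** * Tails of asymptotically uniformly integrable functions *)

Definition tail (S : Type) (R : realType) (h : S -> \bar R) (K : R) (s : S) :=
  `|h s| * (\1_[set y | (K%:E <= `|h y|)%E] s)%:E.

Lemma tail_ge0 (S : Type) (R : realType) (h : S -> \bar R) (K : R) (s : S) :
  0 <= tail h K s.
Proof. by rewrite mule_ge0// lee_fin. Qed.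

Lemma measurable_tail d (S : measurableType d) (R : realType)
    (h : S -> \bar R) (K : R) :
  measurable_fun [set: S] h -> measurable_fun [set: S] (tail h K).
Proof.
move=> mh.
have mah : measurable_fun [set: S] (fun s => `|h s|).
  exact: measurableT_comp.
apply: emeasurable_funM => //; apply/measurable_EFinP.
apply: measurable_indic.
rewrite -[X in measurable X]setTI.
exact: emeasurable_fun_c_infty.
Qed.

Lemma asymptotically_uniformly_integrable_tail d (S : measurableType d)
    (R : realType) (mu_ : {measure set S -> \bar R}^nat) (h : S -> \bar R)
    (e : R) : (0 < e)%R ->
  asymptotically_uniformly_integrable mu_ h ->
  exists2 K : R, (0 <= K)%R & \forall n \near \oo,
    \int[mu_ n]_s tail h K s < e%:E.
Proof.
move=> e0 aui.
have /aui[M [_ MP]] : nbhs (0 : \bar R) [set y | y < e%:E].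
  by apply: open_ereal_lt'; rewrite lte_fin.
(* The limit in the threshold controls only values strictly above [M], hence [M + 1]; the maximum
   with 0 makes the threshold a legitimate truncation level. *)
exists (Num.max 0 (M + 1))%R; first by rewrite le_max lexx.
have /MP/ereal_inf_lt[_ [V Voo <-] supVe] : (M < Num.max 0 (M + 1))%R.
  by rewrite lt_max ltrDl ltr01 orbT.
apply: filterS Voo => n Vn; apply: le_lt_trans supVe.
by apply: ereal_sup_ubound; exists n.
Qed.

(** * Truncation from below at level [- K], for one measure *)

Section truncation.
Context d (S : measurableType d) (R : realType).
Variables (mu : {measure set S -> \bar R}) (g h : S -> \bar R) (K : R).
Hypotheses (mg : measurable_fun [set: S] g) (mh : measurable_fun [set: S] h).
Hypotheses (K0 : (0 <= K)%R) (gh : forall s, g^\- s <= h s).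

(** Where the negative part of [g] exceeds [K], so does [h], and the tail is then all of [h]. Using
    the tail of the dominating [h] lets one estimate serve a whole increasing sequence. *)
Lemma le_min_tail s :
  g^\- s <= mine (g^\- s) K%:E + tail h K s.
Proof.
have h0 : 0 <= h s by apply: le_trans (gh s).
rewrite /tail gee0_abs//.
have [gK|Kg] := leP (g^\- s) K%:E.
  by rewrite leeDl// mule_ge0// lee_fin.
rewrite indicE mem_set/=; last first.
  by rewrite gee0_abs//; apply: le_trans (gh s); exact: ltW.
by rewrite mule1; apply: le_trans (gh s) _; rewrite leeDr// lee_fin.
Qed.

(** This is [(g + K)^+ = g^+ + K - min(g^-, K)], with the minimum moved to the left so that every
    term is nonnegative and integrates additively. *)
Lemma trunc_decomposition s :
  maxe (g s + K%:E) 0 + mine (g^\- s) K%:E = g^\+ s + K%:E.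
Proof.
rewrite funeposE funenegE; case: (g s) => [x| |] /=.
- rewrite -?EFin_max -?EFin_min -?EFinD; congr EFin.
  rewrite /Num.max /Num.min; case: (ltP (- x)%R 0%R) => ?; do ![case: ltP => ?]; have := K0; lra.
- by rewrite !addye// maxNye -EFin_min.
- by rewrite !maxNye maxye minye.
Qed.

Let measurable_trunc : measurable_fun [set: S] (fun s => maxe (g s + K%:E) 0).
Proof. by apply: measurable_maxe => //; exact: emeasurable_funD. Qed.

Let measurable_min : measurable_fun [set: S] (fun s => mine (g^\- s) K%:E).
Proof. by apply: measurable_mine => //; exact: measurable_funeneg. Qed.

Let trunc_ge0 s : 0 <= maxe (g s + K%:E) 0.
Proof. by rewrite le_max lexx orbT. Qed.

Let min_ge0 s : 0 <= mine (g^\- s) K%:E.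
Proof. by rewrite le_min funeneg_ge0 lee_fin. Qed.

Lemma integral_trunc :
  \int[mu]_s maxe (g s + K%:E) 0 + \int[mu]_s mine (g^\- s) K%:E =
  \int[mu]_s g^\+ s + K%:E * mu setT.
Proof.
rewrite -integral_cst// -!ge0_integralD//.
- by apply: eq_integral => s _; exact: trunc_decomposition.
- exact: measurable_funepos.
Qed.

Lemma integral_min_le : \int[mu]_s mine (g^\- s) K%:E <= K%:E * mu setT.
Proof.
rewrite -integral_cst//.
by apply: ge0_le_integral => // s _; rewrite ge_min lexx orbT.
Qed.

Lemma integral_min_le_neg : \int[mu]_s mine (g^\- s) K%:E <= \int[mu]_s g^\- s.
Proof.
apply: ge0_le_integral => //; first exact: measurable_funeneg.
by move=> s _; rewrite ge_min lexx.
Qed.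

Lemma integral_neg_le :
  \int[mu]_s g^\- s <=
  \int[mu]_s mine (g^\- s) K%:E + \int[mu]_s tail h K s.
Proof.
rewrite -ge0_integralD//; last 2 first.
  by move=> s _; exact: tail_ge0.
  exact: measurable_tail.
apply: ge0_le_integral => //; first exact: measurable_funeneg.
  by apply: emeasurable_funD => //; exact: measurable_tail.
by move=> s _; exact: le_min_tail.
Qed.

Lemma le_integral_trunc : \int[mu]_s g^\- s < +oo -> mu setT < +oo ->
  \int[mu]_s g s + K%:E * mu setT <= \int[mu]_s maxe (g s + K%:E) 0.
Proof.
move=> Nfin Mfin; rewrite integralE.
have N0 : 0 <= \int[mu]_s g^\- s by apply: integral_ge0.
have B0 : 0 <= \int[mu]_s mine (g^\- s) K%:E by apply: integral_ge0.
have P0 : 0 <= \int[mu]_s g^\+ s by apply: integral_ge0.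
have A0 : 0 <= \int[mu]_s maxe (g s + K%:E) 0 by apply: integral_ge0.
have M0 : 0 <= mu setT by [].
move: Nfin Mfin N0 B0 P0 A0 M0 integral_trunc integral_min_le_neg.
move: (\int[mu]_s g^\- s) (\int[mu]_s mine (g^\- s) K%:E) (\int[mu]_s g^\+ s)
  (\int[mu]_s maxe (g s + K%:E) 0) (mu setT).
move=> [N| |] [B| |] [P| |] [A| |] [M| |]//=.
rewrite -?EFinM -?EFinN -?EFinD ?lee_fin => _ _ _ _ _ _ _ [] /=; lra.
Qed.

(** By [integral_neg_le], replacing the truncated negative part by the full one costs at most [e].
    The integral of [g^\-] is finite here, being at most [K%:E * mu setT + e%:E]. *)
Lemma integral_trunc_le e : mu setT < +oo -> \int[mu]_s tail h K s <= e%:E ->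
  \int[mu]_s maxe (g s + K%:E) 0 <= \int[mu]_s g s + K%:E * mu setT + e%:E.
Proof.
move=> Mfin te; rewrite (integralE _ _ g).
have N0 : 0 <= \int[mu]_s g^\- s by apply: integral_ge0.
have B0 : 0 <= \int[mu]_s mine (g^\- s) K%:E by apply: integral_ge0.
have P0 : 0 <= \int[mu]_s g^\+ s by apply: integral_ge0.
have A0 : 0 <= \int[mu]_s maxe (g s + K%:E) 0 by apply: integral_ge0.
have M0 : 0 <= mu setT by [].
have := le_trans integral_neg_le (leeD (lexx _) te).
move: Mfin N0 B0 P0 A0 M0 integral_trunc integral_min_le.
move: (\int[mu]_s g^\- s) (\int[mu]_s mine (g^\- s) K%:E) (\int[mu]_s g^\+ s)
  (\int[mu]_s maxe (g s + K%:E) 0) (mu setT).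
move=> [N| |] [B| |] [P| |] [A| |] [M| |]//=.
rewrite -?EFinM -?EFinN -?EFinD ?lee_fin => _ _ _ _ _ _ [] /=; lra.
Qed.
End truncation.

(** * Strict bounds and limits in the extended reals *)

Lemma cvge_lt_near (R : realType) (u : (\bar R)^nat) (l b : \bar R) :
  u n @[n --> \oo] --> l -> l < b -> \forall n \near \oo, u n < b.
Proof. by move=> ul lb; have /(_ _ (open_ereal_lt' lb)) := ul. Qed.

Lemma cvge_squeeze (R : realType) (u : (\bar R)^nat) (l : R) :
  (forall a : R, (a < l)%R -> \forall n \near \oo, a%:E < u n) ->
  (forall b : R, (l < b)%R -> \forall n \near \oo, u n < b%:E) ->
  u n @[n --> \oo] --> l%:E.
Proof.
move=> lower upper.
(* The bounds [l - 1] and [l + 1] make the sequence eventually finite, after which convergence is a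
   statement about reals. *)
apply/fine_cvgP; split.
  have I1 : (l - 1 < l)%R by lra.
  have I2 : (l < l + 1)%R by lra.
  near=> n; rewrite fin_real//; apply/andP; split.
    by apply: (@lt_trans _ _ (l - 1)%:E); rewrite ?ltNyr//; near: n; exact: lower.
  by apply: (@lt_trans _ _ (l + 1)%:E); rewrite ?ltry//; near: n; exact: upper.
apply/cvgrPdist_lt => e e0.
have I1 : (l - e < l)%R by lra.
have I2 : (l < l + e)%R by lra.
near=> n.
have : (l - e)%:E < u n by near: n; exact: lower.
have : u n < (l + e)%:E by near: n; exact: upper.
rewrite /comp; case: (u n) => [r| |]//=.
by rewrite !lte_fin ltr_norml => ? ?; apply/andP; split; lra.
Unshelve. all: by end_near. Qed.

(** One [e] will pay for the tail integral, the other for the error in the total mass times [K]. *)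
Lemma lte_shift (R : realType) (a : R) (x : \bar R) : a%:E < x ->
  exists2 e : R, (0 < e)%R & (a + e + e)%:E < x.
Proof.
case: x => [x| |]//; last by exists 1%R; rewrite ?ltry.
rewrite lte_fin => ax; exists ((x - a) / 3)%R; first by lra.
by rewrite lte_fin; lra.
Qed.

(** * Fatou's lemma for functions unbounded below *)

Section fatou.
Context d (S : measurableType d) (R : realType).
Variables (mu_ : {measure set S -> \bar R}^nat)
  (mu : {measure set S -> \bar R}).
Variables (g_ : (S -> \bar R)^nat) (g : S -> \bar R).
Hypotheses (muT : mu setT < +oo) (mu_cvg : setwise_converges mu_ mu)
  (mg_ : forall n, measurable_fun [set: S] (g_ n))
  (ndg : forall s, nondecreasing_seq (fun n => g_ n s))
  (g_lim : forall s, g_ n s @[n --> \oo] --> g s)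
  (aui : asymptotically_uniformly_integrable mu_ (g_ 0%N)^\-).

Lemma le_limit n s : g_ n s <= g s.
Proof.
rewrite -(cvg_lim _ (@g_lim s))//; apply: lime_ge; first by apply/cvg_ex; exists (g s).
by exists n => // m nm; exact: ndg.
Qed.

Let mg : measurable_fun [set: S] g.
Proof. by apply: (emeasurable_fun_cvg g_) => // s _; exact: g_lim. Qed.

Let mh : measurable_fun [set: S] (g_ 0%N)^\-.
Proof. exact: measurable_funeneg. Qed.

Let funeneg_le_first (k : S -> \bar R) :
  (forall s, g_ 0%N s <= k s) -> forall s, k^\- s <= (g_ 0%N)^\- s.
Proof.
by move=> gk s; apply: (@funeneg_le _ _ setT) => //; rewrite inE.
Qed.

(** The truncated part is at most [K%:E * mu setT]. If the tail had infinite [mu]-integral, Fatou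
    for the constant sequence would push its [mu_ n]-integrals above 1, against the choice of
    [K]. *)
Lemma integral_neg_lty : \int[mu]_s g^\- s < +oo.
Proof.
have [K K0 tailK] := asymptotically_uniformly_integrable_tail ltr01 aui.
have gh := funeneg_le_first (le_limit 0%N).
apply: le_lt_trans (integral_neg_le mu mg mh K0 gh) _.
apply: lte_add_pinfty.
  apply: le_lt_trans (integral_min_le mu mg K0) _.
  by rewrite lte_mul_pinfty ?lee_fin.
rewrite ltNge; apply/negP => tailoo.
have mt : measurable_fun [set: S] (tail (g_ 0%N)^\- K) by exact: measurable_tail.
have : \forall n \near \oo, 1%:E < \int[mu_ n]_s tail (g_ 0%N)^\- K s.
  apply: (@fatou_setwise _ _ _ mu_ mu (fun=> tail (g_ 0%N)^\- K)) => //.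
  - by move=> n s; exact: tail_ge0.
  - by move=> s m n _; exact: lexx.
  - under eq_integral do rewrite lim_cst//.
    by apply: lt_le_trans tailoo; rewrite ltry.
move=> tail1.
have [n []] : exists n, \int[mu_ n]_s tail (g_ 0%N)^\- K s < 1%:E /\
    1%:E < \int[mu_ n]_s tail (g_ 0%N)^\- K s.
  by apply: (@filter_ex _ \oo); near=> n; split; near: n.
by move=> /lt_trans/[apply]; rewrite ltxx.
Unshelve. all: by end_near. Qed.

Lemma fatou_setwise_asymptotically_uniformly_integrable (a : R) :
  a%:E < \int[mu]_s g s -> \forall n \near \oo, a%:E < \int[mu_ n]_s g_ n s.
Proof.
move=> /lte_shift[e e0 ae].
have [K K0 tailK] := asymptotically_uniformly_integrable_tail e0 aui.
pose w n s := maxe (g_ n s + K%:E) 0.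
have mw n : measurable_fun [set: S] (w n).
  by apply: measurable_maxe => //; exact: emeasurable_funD.
have ndw s : nondecreasing_seq (fun n => w n s).
  by move=> n m nm; rewrite /w ge_max !le_max lexx orbT andbT leeD2r// ndg.
have w0 n s : 0 <= w n s by rewrite le_max lexx orbT.
have le_trunc_lim s : maxe (g s + K%:E) 0 <= limn (w ^~ s).
  have cw : cvgn (w ^~ s) by exact: ereal_nondecreasing_is_cvgn.
  rewrite ge_max; apply/andP; split; last by apply: lime_ge => //; exact: nearW.
  have gK : g_ n s + K%:E @[n --> \oo] --> g s + K%:E.
    by apply: cvgeD; [rewrite fin_num_adde_defl|exact: g_lim|exact: cvg_cst].
  rewrite -(cvg_lim _ gK)//; apply: lee_lim => //.
    by apply/cvg_ex; exists (g s + K%:E).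
  by apply: nearW => n; rewrite le_max lexx.
have Mfin : mu setT = (fine (mu setT))%:E by rewrite fineK// ge0_fin_numE.
pose M := fine (mu setT).
have wlt : (a + e + e + K * M)%:E < \int[mu]_s limn (w ^~ s).
  apply: (@lt_le_trans _ _ (\int[mu]_s maxe (g s + K%:E) 0)); last first.
    apply: ge0_le_integral => //.
    - by move=> s _; rewrite le_max lexx orbT.
    - by apply: measurable_maxe => //; exact: emeasurable_funD.
    - apply: (emeasurable_fun_cvg w) => // s _.
      exact: ereal_nondecreasing_is_cvgn.
  apply: lt_le_trans (le_integral_trunc mg K0 integral_neg_lty muT).
  by rewrite EFinD Mfin lte_leD.
have wlt_ := fatou_setwise mu_cvg mw w0 ndw wlt.
have KM : \forall n \near \oo, K%:E * mu_ n setT < (K * M + e)%:E.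
  apply: (@cvge_lt_near _ _ (K%:E * mu setT)).
    by apply: cvgeZl => //; exact: mu_cvg.
  by rewrite Mfin lte_fin ltrDl.
(* The measures [mu_ n] are not assumed finite; convergence on the whole space makes them so
   eventually. *)
have M_ : \forall n \near \oo, mu_ n setT < +oo.
  by apply: cvge_lt_near muT; exact: mu_cvg.
near=> n.
have gh := funeneg_le_first (fun s => @ndg s _ _ (leq0n n)).
have tn : \int[mu_ n]_s tail (g_ 0%N)^\- K s <= e%:E by apply: ltW; near: n.
have Mn : mu_ n setT < +oo by near: n.
have wn : (a + e + e + K * M)%:E < \int[mu_ n]_s w n s by near: n.
have KMn : K%:E * mu_ n setT < (K * M + e)%:E by near: n.
(* With [M] the mass of [mu] and [I] the integral of [g_ n]: [a + 2e + K M < I + K mu_n(S) + e < I +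
   K M + 2e], so [a < I]. *)
have := lt_le_trans wn
  (integral_trunc_le (mg_ n) mh K0 gh Mn tn).
move: Mn KMn; have : 0 <= mu_ n setT by [].
case: (mu_ n setT) => [m| |]// _ _.
case: (\int[mu_ n]_s g_ n s) => [I| |]//.
  rewrite -EFinM -!EFinD !lte_fin; lra.
by move=> _ _; rewrite ltry.
Unshelve. all: by end_near. Qed.
End fatou.


(** * Two-sided bounds for the integrals of [f_ n] *)

Theorem corollary6p6 (R : realType) (d : measure_display)
    (S : measurableType d)
    (mu_ : {measure set S -> \bar R}^nat)
    (mu : {finite_measure set S -> \bar R})
    (f_ : (S -> \bar R)^nat) (f : S -> \bar R)
    (mu_cvg : setwise_converges mu_ mu)
    (f_measurable : forall n, measurable_fun [set: S] (f_ n))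
    (f_nondecreasing : forall s, nondecreasing_seq (fun n => f_ n s))
    (f_defined : forall n, integral_defined (mu_ n) (f_ n))
    (f_lim : forall s, f_ n s @[n --> \oo] --> f s)
    (f1_neg_aui : asymptotically_uniformly_integrable mu_ (f_ 0%N)^\-)
    (f_pos_aui : asymptotically_uniformly_integrable mu_ f^\+) :
  integral_defined mu f /\
  \int[mu_ n]_s f_ n s @[n --> \oo] --> \int[mu]_s f s.
Proof.
have muT : mu setT < +oo by rewrite ltey_eq fin_num_measure.
have mf : measurable_fun [set: S] f.
  by apply: (emeasurable_fun_cvg f_) => // s _; exact: f_lim.
have mNf : measurable_fun [set: S] (\- f) by exact: measurableT_comp.
have ndNf (s : S) : nondecreasing_seq (fun=> (\- f) s) by move=> m n _; exact: lexx.
have Nf_lim (s : S) : (fun=> (\- f) s) @ \oo --> (\- f) s by exact: cvg_cst.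
have Nf_aui : asymptotically_uniformly_integrable mu_ (\- f)^\- by rewrite funenegN.
(* Finiteness for [f_] and for the constant sequence [\- f] bounds both parts of [f], so its
   [mu]-integral is a real [I]. *)
have Nfin := integral_neg_lty muT mu_cvg f_measurable
  f_nondecreasing f_lim f1_neg_aui.
have := integral_neg_lty muT mu_cvg (fun=> mNf)
  ndNf Nf_lim Nf_aui.
rewrite funenegN => Pfin.
split; first by rewrite /integral_defined gt_min Pfin.
have N0 : 0 <= \int[mu]_s f^\- s by apply: integral_ge0.
have P0 : 0 <= \int[mu]_s f^\+ s by apply: integral_ge0.
have [I intf] : exists I, \int[mu]_s f s = I%:E.
  exists (fine (\int[mu]_s f^\+ s) - fine (\int[mu]_s f^\- s))%R.
  by rewrite integralE EFinB !fineK// ge0_fin_numE.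
have lower a : (a < I)%R -> \forall n \near \oo, a%:E < \int[mu_ n]_s f_ n s.
  move=> aI.
  apply: (@fatou_setwise_asymptotically_uniformly_integrable _ _ _ mu_ mu f_ f) => //.
  by rewrite intf lte_fin.
have upper b : (I < b)%R -> \forall n \near \oo, \int[mu_ n]_s f_ n s < b%:E.
  move=> Ib.
  have : \forall n \near \oo, (- b)%:E < \int[mu_ n]_s (\- f) s.
    apply: (@fatou_setwise_asymptotically_uniformly_integrable _ _ _ mu_ mu
      (fun=> \- f) (\- f)) => //.
    rewrite integralN ?intf -?EFinN ?lte_fin ?ltrN2//.
    by rewrite fin_num_adde_defl// fin_numN ge0_fin_numE.
  apply: filterS => n.
  have fnf s : f_ n s <= f s by exact: le_limit f_nondecreasing f_lim _ _.
  have PP : \int[mu_ n]_s (f_ n)^\+ s <= \int[mu_ n]_s f^\+ s.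
    apply: ge0_le_integral => //; [exact: measurable_funepos|exact: measurable_funepos|].
    by move=> s _; apply: (@funepos_le _ _ setT) => //; rewrite inE.
  have NN : \int[mu_ n]_s f^\- s <= \int[mu_ n]_s (f_ n)^\- s.
    apply: ge0_le_integral => //; [exact: measurable_funeneg|exact: measurable_funeneg|].
    by move=> s _; apply: (@funeneg_le _ _ setT) => //; rewrite inE.
  (* The positive and negative parts are compared separately, since the parts of [f] may have
     infinite [mu_ n]-integrals. As [+oo - +oo] is [-oo], the strict bound [-b < Q - P] forces [P]
     finite; if [q] is infinite, then [p - q] is [-oo]. *)
  rewrite integralE funeposN funenegN (integralE _ _ (f_ n)).
  have : 0 <= \int[mu_ n]_s f^\- s by apply: integral_ge0.
  have : 0 <= \int[mu_ n]_s (f_ n)^\+ s by apply: integral_ge0.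
  move: PP NN.
  move: (\int[mu_ n]_s (f_ n)^\+ s) (\int[mu_ n]_s (f_ n)^\- s)
    (\int[mu_ n]_s f^\+ s) (\int[mu_ n]_s f^\- s).
  move=> [p| |] [q| |] [P| |] [Q| |]//=.
  - by rewrite -?EFinN -?EFinD !lte_fin !lee_fin; lra.
  - by move=> *; rewrite ltNyr.
  - by move=> *; rewrite ltNyr.
by have := cvge_squeeze lower upper; rewrite -intf.
Qed.
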